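(* Let $X$ and $Y$ be completely regular topological spaces and let $f:X \times Y \to [-\infty, +\infty]$ be an extended real-valued function such that: (A1) for any $y \in Y$ the function $f(\cdot, y)$ is upper semicontinuous on $X$; (A2) the function $v_f$ is bounded above on $X$ and proper as a function with values in $\mathbb{R} \cup \{-\infty\}$; (A3) for any $x \in X$ the function $f(x,\cdot)$ is lower semicontinuous on $Y$; (A4) the function $w_f$ is bounded below on $Y$ and proper as a function with values in $\mathbb{R} \cup \{+\infty\}$. Let $S_f: C(X) \times C(Y) \rightrightarrows X \times Y$ be the set-valued mapping which assigns to every pair $(s,u)\in C(X)\times C(Y)$ the (possibly empty) set of saddle points on $X\times Y$ of the function $(x,y)\mapsto f(x,y)+s(x)+u(y)$. Then, for $(s,u) \in C(X) \times C(Y)$, the mapping $S_f$ is single-valued and upper semicontinuous at $(s,u)$ if and only if the saddle point problem for the function $f(x,y)+s(x)+u(y)$ is well-posed.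
   Context: Completely regular spaces are assumed Hausdorff. $C(X)$ denotes the Banach space of all continuous bounded real-valued functions on $X$ with the supremum norm $\|\cdot\|_\infty$, and similarly for $C(Y)$; $C(X)\times C(Y)$ carries the product topology. For any $F:X \times Y \to [-\infty, +\infty]$ put $v_F(x) := \inf_{y \in Y} F(x,y)$ for $x\in X$, $w_F(y) := \sup_{x \in X} F(x,y)$ for $y\in Y$, $V_F:=\sup_{x\in X} v_F(x)$, $W_F:=\inf_{y\in Y} w_F(y)$ and $\Delta_F := W_F-V_F$. An extended real-valued function is proper if it takes a finite value at some point. A point $(x_0,y_0)\in X\times Y$ is a saddle point of $F$ on $X \times Y$ (a solution of the saddle point problem for $F$) if $F(x,y_0) \leq F(x_0,y_0) \leq F(x_0,y)$ for all $x \in X$, $y \in Y$. A sequence $\{(x_n,y_n)\}_n\subset X\times Y$ is optimizing for the saddle point problem for $F$ if $v_F(x_n)\to V_F$, $w_F(y_n)\to W_F$ and $\Delta_F=0$. The saddle point problem for $F$ is well-posed if it has a unique solution and every sequence optimizing for it converges to this solution. ''$S_f$ is single-valued at $(s,u)$'' means that $S_f(s,u)$ consists of exactly one point; ''$S_f$ is upper semicontinuous at $(s,u)$'' means that for every open set $O\subset X\times Y$ with $S_f(s,u)\subset O$ there is a neighbourhood $N$ of $(s,u)$ in $C(X)\times C(Y)$ such that $S_f(s',u')\subset O$ for all $(s',u')\in N$. *)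

(* Defs.v *)
From HB Require Import structures.
From mathcomp Require Import all_boot all_order all_algebra.
From mathcomp Require Import all_classical all_reals all_analysis.

Set Implicit Arguments.
Unset Strict Implicit.
Unset Printing Implicit Defensive.
Import Order.TTheory GRing.Theory Num.Theory.
Import numFieldNormedType.Exports.
Local Open Scope classical_set_scope.
Local Open Scope ring_scope.

(* bcfun X R is the space C(X) of bounded continuous functions X -> R with the
   norm sup_x |f x|. For empty X it is the zero space, as sup set0 = 0. *)
Section BoundedContinuous.
Context (X : topologicalType) (R : realType).

Definition bcont : {pred X -> R} :=
  mem [set f : X -> R | continuous f /\ bounded_fun f].

Lemma bcontP (f : X -> R) : f \in bcont <-> continuous f /\ bounded_fun f.
Proof. by split => [/set_mem|h]; [|exact/mem_set]. Qed.

Lemma bcont_submod_closed : submod_closed bcont.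
Proof.
split=> [|a f g /bcontP[cf [M [Mr fM]]] /bcontP[cg bg]]; apply/bcontP; split.
- by move=> x; exact: cst_continuous.
- by exists 0; split=> // M M0 x _ /=; rewrite normr0 ltW.
- by move=> x; apply: cvgD; [apply: cvgZl_tmp; exact: cf|exact: cg].
- apply: (@bounded_funD _ _ (a *: f)) bg.
  exists (`|a| * (M + 1)); split=> [|N aN x _ /=].
    by rewrite realM// realD.
  rewrite normrM (le_trans _ (ltW aN))// ler_wpM2l//.
  by apply: fM => //; rewrite ltrDl.
Qed.

HB.instance Definition _ := GRing.isSubmodClosed.Build _ _ bcont
  bcont_submod_closed.

Record bcfun := BCFun { bcfun_fun :> X -> R; bcfun_in : bcfun_fun \in bcont }.

HB.instance Definition _ := [isSub for bcfun_fun].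
HB.instance Definition _ := [Choice of bcfun by <:].
HB.instance Definition _ := [SubChoice_isSubLmodule of bcfun by <:].

Definition supnorm (f : bcfun) : R := sup (range (fun x => `|f x|)).

Lemma supnorm_ubound (f : bcfun) x : `|f x| <= supnorm f.
Proof.
apply: ub_le_sup; last by exists x.
have /bcontP[_ [M [_ fM]]] := bcfun_in f.
by exists (M + 1) => _ [y _ <-]; apply: fM => //; rewrite ltrDl.
Qed.

Lemma supnorm_le (f : bcfun) M :
  0 <= M -> (forall x, `|f x| <= M) -> supnorm f <= M.
Proof.
move=> M0 fM; have [e0|/set0P ne] := eqVneq (range (fun x => `|f x|)) set0; last first.
  by apply: ge_sup => // _ [y _ <-].
by rewrite /supnorm e0 sup0.
Qed.

Lemma supnorm_ge0 (f : bcfun) : 0 <= supnorm f.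
Proof.
have [[y _]|/set0P/negP/negPn/eqP e0] := pselect ([set: X] !=set0).
  exact: le_trans (supnorm_ubound f y).
by rewrite /supnorm e0 image_set0 sup0.
Qed.

Lemma supnormD (f g : bcfun) : supnorm (f + g) <= supnorm f + supnorm g.
Proof.
apply: supnorm_le => [|x]; first by rewrite addr_ge0 ?supnorm_ge0.
by rewrite (le_trans (ler_normD _ _))// lerD ?supnorm_ubound.
Qed.

Lemma supnormZ (a : R) (f : bcfun) : supnorm (a *: f) = `|a| * supnorm f.
Proof.
have le b h : supnorm (b *: h) <= `|b| * supnorm h.
  apply: supnorm_le => [|x]; first by rewrite mulr_ge0 ?supnorm_ge0.
  by rewrite [_ x]/= normrM ler_wpM2l ?supnorm_ubound.
apply/eqP; rewrite eq_le le/=.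
have [->|a0] := eqVneq a 0; first by rewrite normr0 mul0r supnorm_ge0.
rewrite -ler_pdivlMl ?normr_gt0// -normfV.
by rewrite -[in leLHS](scalerK a0 f) le.
Qed.

Lemma supnorm0_eq0 (f : bcfun) : supnorm f = 0 -> f = 0.
Proof.
move=> f0; apply/val_inj/funext => x; apply/eqP; rewrite -normr_le0 -f0.
exact: supnorm_ubound.
Qed.

HB.instance Definition _ :=
  Lmodule_isNormed.Build R bcfun supnormD supnormZ supnorm0_eq0.

End BoundedContinuous.

Section Semicontinuity.
Local Open Scope ereal_scope.

(* Mirror image of lower_semicontinuous. *)
Definition upper_semicontinuous (X : topologicalType) (R : numFieldType)
    (f : X -> \bar R) :=
  forall x a, f x < a%:E -> exists2 V, nbhs x V & forall y, V y -> f y < a%:E.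

End Semicontinuity.

Section ExtendedFunctions.
Context (T : Type) (R : realType).
Implicit Type g : T -> \bar R.
Local Open Scope ereal_scope.

Definition bounded_above g := exists M : R, forall t, g t <= M%:E.

Definition bounded_below g := exists M : R, forall t, M%:E <= g t.

Definition eproper g := exists t, g t \is a fin_num.

End ExtendedFunctions.

Section SaddlePoints.
Context (R : realType) (X Y : Type).
Implicit Type F : X -> Y -> \bar R.
Local Open Scope ereal_scope.

Definition low_value F (x : X) := ereal_inf (range (fun y => F x y)).

Definition upp_value F (y : Y) := ereal_sup (range (fun x => F x y)).

Definition sup_low_value F := ereal_sup (range (low_value F)).

Definition inf_upp_value F := ereal_inf (range (upp_value F)).

(* The difference is conventional only when both values are the same infinity;
   this does not happen when they are the sup and inf of functions satisfying
   the boundedness and properness conditions above. *)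
Definition saddle_gap F := inf_upp_value F - sup_low_value F.

Definition saddle_points F : set (X * Y) :=
  [set p | forall x y, F x p.2 <= F p.1 p.2 /\ F p.1 p.2 <= F p.1 y].

Definition optimizing F (z : nat -> X * Y) :=
  [/\ low_value F (z n).1 @[n --> \oo] --> sup_low_value F,
      upp_value F (z n).2 @[n --> \oo] --> inf_upp_value F &
      saddle_gap F = 0].

Definition perturb F (s : X -> R) (u : Y -> R) : X -> Y -> \bar R :=
  fun x y => F x y + (s x)%:E + (u y)%:E.

End SaddlePoints.

Definition saddle_well_posed (R : realType) (X Y : topologicalType)
    (F : X -> Y -> \bar R) :=
  exists2 p : X * Y, saddle_points F = [set p] &
    forall z : nat -> X * Y, optimizing F z -> z n @[n --> \oo] --> p.

Definition saddle_map (R : realType) (X Y : topologicalType)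
    (f : X -> Y -> \bar R) (su : bcfun X R * bcfun Y R) : set (X * Y) :=
  saddle_points (perturb f su.1 su.2).

Definition single_valued_at (T U : Type) (S : T -> set U) (t : T) :=
  exists p, S t = [set p].

Definition set_usc_at (T U : topologicalType) (S : T -> set U) (t : T) :=
  forall O, open O -> S t `<=` O ->
    exists2 N, nbhs t N & forall t', N t' -> S t' `<=` O.

(* Main.v *)
Require Import Defs.
From HB Require Import structures.
From mathcomp Require Import all_boot all_order all_algebra.
From mathcomp Require Import all_classical all_reals all_analysis.
From mathcomp Require Import ring lra.

Set Implicit Arguments.
Unset Strict Implicit.
Unset Printing Implicit Defensive.
Import Order.TTheory GRing.Theory Num.Theory.
Import numFieldNormedType.Exports.
Local Open Scope classical_set_scope.
Local Open Scope ring_scope.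

(** Write F for f + s + u.

    Well-posedness implies upper semicontinuity because a saddle point z of a
    function within d of F (d in each of the two perturbations) satisfies
    F x z.2 <= F z.1 y + 4 d for all x and y: it is a saddle point of F up to
    4 d ([saddle_perturb_approx]).  If saddle points of ever smaller
    perturbations stayed outside an open set O around the solution p of F, they
    would form an optimizing sequence ([optimizing_of_approx_saddle]), which
    must converge to p and so enter O.  The boundedness of v_f and w_f enters
    here: it makes the saddle value F p finite ([saddle_perturb_fin]), without
    which an additive error would control nothing.

    Conversely, a term (x_n, y_n) far along an optimizing sequence is a saddle
    point of F up to an arbitrarily small d ([optimizing_approx_saddle]), and an
    approximate saddle point becomes an exact one after a small perturbation
    ([approx_saddle_perturb]).  Hence (x_n, y_n) belongs to S_f (s', u') for some
    (s', u') close to (s, u), and upper semicontinuity puts it in any prescribed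
    neighbourhood of p.

    The perturbation comes from a variational principle ([penalty_touching]): if
    g is upper semicontinuous and g x0 is within d of the supremum of g, there
    is a continuous h of norm at most 2 d, vanishing at x0, such that g - h is
    maximal at x0.  It is applied to the partial functions x |-> F x y_n and
    y |-> - F x_n y, rather than to the value functions v_F and w_F.  This keeps
    the two perturbations independent: h vanishes at x_n and its analogue k at
    y_n, so each of the two saddle inequalities involves only one of them. *)

(** * Continuous penalties on a completely regular space *)

(** The Weierstrass M-test: the tails of the series are dominated by those of
    M, uniformly in x, so the sum is a uniform limit of continuous functions. *)
Lemma continuous_series_Mtest (X : topologicalType) (R : realType)
    (g : nat -> X -> R) (M : R ^nat) :
  (forall n, continuous (g n)) -> (forall n x, `|g n x| <= M n) ->
  cvgn (series M) -> continuous (fun x => limn (series (g ^~ x))).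
Proof.
move=> cg gM cM.
have cS x : cvgn (series (g ^~ x)).
  apply: normed_cvg; apply: (series_le_cvg _ _ _ cM) => n //.
  - exact: normr_ge0.
  - exact: le_trans (gM n x).
  - exact: gM.
have tail n x : `|limn (series (g ^~ x)) - series (g ^~ x) n|
    <= limn (series M) - series M n.
  apply: (@ler_cvg_to _ \oo _ _ (fun m => `|series (g ^~ x) m - series (g ^~ x) n|)
     (fun m => series M m - series M n)).
  - by apply: cvg_norm; apply: cvgB; [exact: cS|exact: cvg_cst].
  - by apply: cvgB; [exact: cM|exact: cvg_cst].
  - near=> m; have nm : (n <= m)%N by near: m; exact: nbhs_infty_ge.
    rewrite !sub_series_geq//.
    by apply: le_trans (ler_norm_sum _ _ _) _; exact: ler_sum.
apply: (@uniform_limit_continuous _ _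
  ((fun n x => series (g ^~ x) n) @ \oo)).
- near_simpl; apply: nearW => n; rewrite /series /=.
  elim: n => [|n IH] x.
    by under eq_fun do rewrite big_geq//; exact: cvg_cst.
  under eq_fun do rewrite big_nat_recr//=.
  by apply: cvgD; [exact: IH|exact: cg].
- move=> P /uniform_nbhs[E [/= entE EP]].
  move: entE; rewrite -entourage_ballE => -[d /= d0 dE].
  have : \forall n \near \oo, `|limn (series M) - series M n| < d.
    by move/cvgrPdist_lt : cM; exact.
  apply: filterS => n nd; apply: EP => x _; apply: dE.
  rewrite /ball/=; apply: le_lt_trans (tail n x) _.
  exact: le_lt_trans (ler_norm _) nd.
Unshelve. all: by end_near. Qed.

(** A variational principle.  By upper semicontinuity, g < g x0 + c (n + 1) near
    x0, where c n = e / 2 ^ n; complete regularity provides phi n, with values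
    in [0, 1] and phi n x0 = 0, such that this inequality holds wherever
    phi n < 1.  The penalty is h = sum_n c n * phi n, at most sum_n c n = 2 e.
    For given x, let n be the first index with phi n x = 1: the previous index
    (or the hypothesis on e, if n = 0) gives g x <= g x0 + c n, and
    c n = c n * phi n x <= h x.  If there is no such n then g x <= g x0. *)
Lemma penalty_touching (R : realType) (X : topologicalType)
    (crX : completely_regular_space X) (g : X -> \bar R) (x0 : X) (e : R) :
  upper_semicontinuous g -> g x0 \is a fin_num -> 0 < e ->
  (forall x, g x <= g x0 + e%:E)%E ->
  exists h : bcfun X R, [/\ h x0 = 0, `|h| <= 2 * e &
    forall x, (g x <= g x0 + (h x)%:E)%E].
Proof.
move=> uscg gfin e0 ge.
have [r gr] : exists r, g x0 = r%:E by exists (fine (g x0)); rewrite fineK.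
rewrite gr in ge *.
pose c n : R := e / 2 ^+ n.
have c0 n : 0 < c n by rewrite divr_gt0// exprn_gt0.
have cE : c = geometric e 2^-1.
  by apply/funext => n; rewrite /c/= exprVn.
have half1 : `|2^-1 : R| < 1 by rewrite ger0_norm// invf_lt1// ltr1n.
have cvgc : cvgn (series c) by rewrite cE; exact: is_cvg_geometric_series.
have limc : limn (series c) = 2 * e.
  rewrite cE (cvg_lim _ (cvg_geometric_series _))//.
  by field.
have /choice[phi phiP] : forall n, exists p : X -> R,
    [/\ continuous p, forall x, 0 <= p x <= 1, p x0 = 0 &
      forall x, p x < 1 -> (g x < (r + c n.+1)%:E)%E].
  move=> n.
  have [|V nV VP] := uscg x0 (r + c n.+1); first by rewrite gr lte_fin ltrDl.
  have clV : closed (~` V^°) by apply: open_closedC; exact: open_interior.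
  have /(_ (fun k => k nV)) := crX x0 _ clV.
  move=> /(@uniform_separatorP _ R)[p [cp p01 p0 p1]].
  exists p; split => //; rewrite /=.
  - by move=> x; have /= := p01 (p x) (ex_intro2 _ _ x I erefl); rewrite in_itv.
  - by apply: p0; exists x0.
  - move=> x px1; apply: VP; apply: interior_subset.
    apply: contrapT => nVx.
    have /= px : p x = 1 by apply: p1; exists x.
    by rewrite px ltxx in px1.
pose G n x := c n * phi n x.
have G0 n x : 0 <= G n x.
  by rewrite mulr_ge0 ?(ltW (c0 n))//; have [_ /(_ x)/andP[]] := phiP n.
have Gc n x : G n x <= c n.
  by rewrite ler_piMr ?(ltW (c0 n))//; have [_ /(_ x)/andP[]] := phiP n.
pose h x := limn (series (G ^~ x)).
have cG x : cvgn (series (G ^~ x)).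
  by apply: (series_le_cvg _ _ _ cvgc) => // n; exact: ltW.
have ch : continuous h.
  apply: (continuous_series_Mtest _ _ cvgc) => [n x|n x].
    by apply: cvgM; [exact: cvg_cst|have [+ _ _ _] := phiP n; exact].
  by rewrite ger0_norm.
have Gh n x : G n x <= h x.
  apply: (@le_trans _ _ (series (G ^~ x) n.+1)).
    by rewrite /series/= big_nat_recr//= lerDr sumr_ge0.
  by apply: nondecreasing_cvgn_le => //; exact: nondecreasing_series.
have h0 x : 0 <= h x by exact: le_trans (Gh 0%N x).
have he x : `|h x| <= 2 * e by rewrite ger0_norm// -limc; exact: lim_series_le.
have hP : h \in @bcont X R.
  apply/bcontP; split => //; exists (2 * e); split; first exact: num_real.
  by move=> M eM x _ /=; exact: le_trans (he x) (ltW eM).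
exists (BCFun hP); split => /=.
- rewrite /h (_ : G ^~ x0 = cst 0); last first.
    by apply/funext => n; rewrite /G; have [_ _ -> _] := phiP n; rewrite mulr0.
  rewrite (_ : series _ = cst 0) ?lim_cst//.
  by apply/funext => n; rewrite /series/= big1.
- by apply: supnorm_le => //; rewrite mulr_ge0// ltW.
move=> x; have [ex|nex] := pselect (exists n, 1 <= phi n x).
  have [n /= p1 nmin] := ex_minnP ex.
  apply: (@le_trans _ _ (r + c n)%:E).
    case: n nmin p1 => [|n] nmin p1.
      by rewrite /c expr0 divr1 EFinD; exact: ge.
    have [_ _ _ lt] := phiP n; apply/ltW/lt; rewrite ltNge; apply/negP => /nmin.
    by rewrite ltnn.
  rewrite -EFinD lee_fin lerD2l; apply: le_trans (Gh n x).
  by rewrite ler_peMr// ltW.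
apply: (@le_trans _ _ r%:E); last by rewrite -EFinD lee_fin lerDl.
apply/lee_addgt0Pr => d d0.
have : \forall n \near \oo, c n < d.
  rewrite cE; have /cvgr_lt := cvg_geometric e half1; exact.
case=> N _ /(_ N.+1 (leqnSn N)) /= cd.
have [_ _ _ lt] := phiP N; apply: le_trans (ltW (lt x _)) _.
  by rewrite ltNge; apply/negP => p1; apply: nex; exists N.
by rewrite -EFinD lee_fin lerD2l ltW.
Qed.

(** * Semicontinuity of perturbed functions *)

Lemma upper_semicontinuousD (R : realType) (X : topologicalType)
    (g : X -> \bar R) (s : X -> R) :
  upper_semicontinuous g -> continuous s ->
  upper_semicontinuous (fun x => g x + (s x)%:E)%E.
Proof.
move=> ug cs x a gsa.
(* Any b strictly between g x and a - s x separates the two conditions. *)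
have [b gb sb] : exists2 b : R, (g x < b%:E)%E & s x < a - b.
  move: gsa; case: (g x) => [r| |]//=.
    rewrite -EFinD lte_fin => rsa; exists ((r + (a - s x)) / 2).
      by rewrite lte_fin; lra.
    by lra.
  by move=> _; exists (a - s x - 1); [rewrite ltNyr|lra].
have [V xV Vb] := ug x b gb.
exists (V `&` [set y | s y < a - b]).
  by apply: filterI => //; move/cvgr_lt : (cs x); exact.
move=> y [/Vb gyb /= syb]; rewrite (_ : a = b + (a - b)); last by ring.
by rewrite EFinD; apply: lteD; rewrite // lte_fin.
Qed.

Lemma lower_semicontinuousN (R : realType) (X : topologicalType)
    (g : X -> \bar R) :
  lower_semicontinuous g <-> upper_semicontinuous (fun x => - g x)%E.
Proof.
split=> gsc x a.
- rewrite lteNl -EFinN => /gsc[V xV Va].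
  by exists V => // y /Va; rewrite lteNl -EFinN.
- rewrite -lteN2 -EFinN => /gsc[V xV Va].
  by exists V => // y /Va; rewrite EFinN lteN2.
Qed.

Lemma lower_semicontinuousD (R : realType) (X : topologicalType)
    (g : X -> \bar R) (s : X -> R) :
  lower_semicontinuous g -> continuous s ->
  lower_semicontinuous (fun x => g x + (s x)%:E)%E.
Proof.
move=> /lower_semicontinuousN ug cs; apply/lower_semicontinuousN.
under eq_fun do rewrite oppeD ?fin_num_adde_defl// -EFinN.
by apply: (upper_semicontinuousD ug) => x; apply: cvgN; exact: cs.
Qed.

(** * Saddle points and optimizing sequences *)

Section SaddleValues.
Context (R : realType) (X Y : Type) (F : X -> Y -> \bar R).
Local Open Scope ereal_scope.

Lemma low_value_le x y : low_value F x <= F x y.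
Proof. by apply: ereal_inf_lbound; exists y. Qed.

Lemma upp_value_ge x y : F x y <= upp_value F y.
Proof. by apply: ereal_sup_ubound; exists x. Qed.

Lemma low_value_le_sup x : low_value F x <= sup_low_value F.
Proof. by apply: ereal_sup_ubound; exists x. Qed.

Lemma upp_value_ge_inf y : inf_upp_value F <= upp_value F y.
Proof. by apply: ereal_inf_lbound; exists y. Qed.

Lemma sup_low_le_inf_upp : sup_low_value F <= inf_upp_value F.
Proof.
apply: ge_ereal_sup => _ [x _ <-]; apply: le_ereal_inf_tmp => _ [y _ <-].
exact: le_trans (low_value_le x y) (upp_value_ge x y).
Qed.

Lemma saddle_value p : saddle_points F p ->
  sup_low_value F = F p.1 p.2 /\ inf_upp_value F = F p.1 p.2.
Proof.
move=> pF.
have Flow : F p.1 p.2 <= sup_low_value F.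
  apply: le_trans (low_value_le_sup p.1).
  by apply: le_ereal_inf_tmp => _ [y _ <-]; have [] := pF p.1 y.
have uppF : inf_upp_value F <= F p.1 p.2.
  apply: le_trans (upp_value_ge_inf p.2) _.
  by apply: ge_ereal_sup => _ [x _ <-]; have [] := pF x p.2.
have VW := sup_low_le_inf_upp.
split; apply/le_anti/andP; split => //.
- exact: le_trans VW uppF.
- exact: le_trans Flow VW.
Qed.

(** If one of the two values is infinite, so is their difference, also for two
    equal infinities, where the convention is +oo - +oo = -oo. *)
Lemma saddle_gap0_fin : saddle_gap F = 0 -> exists r : R,
  sup_low_value F = r%:E /\ inf_upp_value F = r%:E.
Proof.
rewrite /saddle_gap.
case: (sup_low_value F) (inf_upp_value F) => [v| |] [w| |]//=.
by rewrite -EFinB => -[/subr0_eq ->]; exists v.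
Qed.

(** Taking the supremum over x and the infimum over y gives
    w_F (y_n) <= v_F (x_n) + e n, while weak duality places the common value r
    between v_F (x_n) and w_F (y_n); both are squeezed towards r. *)
Lemma optimizing_of_approx_saddle (r : R) (z : nat -> X * Y) (e : R ^nat) :
  sup_low_value F = r%:E -> inf_upp_value F = r%:E ->
  e n @[n --> \oo] --> (0 : R)%R ->
  (forall n x y, F x (z n).2 <= F (z n).1 y + (e n)%:E) -> optimizing F z.
Proof.
move=> Vr Wr e0 ze.
have uplow n : upp_value F (z n).2 <= low_value F (z n).1 + (e n)%:E.
  apply: ge_ereal_sup => _ [x _ <-]; rewrite -leeBlDr//.
  by apply: le_ereal_inf_tmp => _ [y _ <-]; rewrite leeBlDr.
have lowr n : low_value F (z n).1 <= r%:E by rewrite -Vr low_value_le_sup.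
have rupp n : r%:E <= upp_value F (z n).2 by rewrite -Wr upp_value_ge_inf.
split; last by rewrite /saddle_gap Vr Wr subee.
- rewrite Vr; apply: (@squeeze_cvge _ _ _ _ (fun n => (r - e n)%:E) _ (cst r%:E)).
  + apply: nearW => n; rewrite lowr andbT EFinB leeBlDr//.
    exact: le_trans (uplow n).
  + apply: cvg_EFin; first exact: nearW.
    by rewrite -[X in _ --> X]subr0; apply: cvgB; [exact: cvg_cst|].
  + exact: cvg_cst.
- rewrite Wr; apply: (@squeeze_cvge _ _ _ _ (cst r%:E) _ (fun n => (r + e n)%:E)).
  + apply: nearW => n; rewrite rupp/= EFinD; apply: le_trans (uplow n) _.
    by rewrite leeD2r.
  + exact: cvg_cst.
  + apply: cvg_EFin; first exact: nearW.
    by rewrite -[X in _ --> X]addr0; apply: cvgD; [exact: cvg_cst|].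
Qed.

(** Once v_F (x_n) and w_F (y_n) are within d / 2 of the common value, the
    bounds v_F (x_n) <= F x_n y and F x y_n <= w_F (y_n) confine F x_n y_n to an
    interval of length d and yield the other two inequalities. *)
Lemma optimizing_approx_saddle (z : nat -> X * Y) (d : R) : (0 < d)%R ->
  optimizing F z -> \forall n \near \oo,
    [/\ F (z n).1 (z n).2 \is a fin_num,
      forall x, F x (z n).2 <= F (z n).1 (z n).2 + d%:E &
      forall y, F (z n).1 (z n).2 <= F (z n).1 y + d%:E].
Proof.
move=> d0 [zV zW /saddle_gap0_fin[r [Vr Wr]]]; rewrite Vr Wr in zV zW.
have lown : \forall n \near \oo, (r - d / 2)%:E < low_value F (z n).1.
  apply: (zV [set v | (r - d / 2)%:E < v]); apply: open_nbhs_nbhs; split.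
    exact: open_ereal_gt_ereal.
  by rewrite /= lte_fin ltrBlDr ltrDl divr_gt0.
have uppn : \forall n \near \oo, upp_value F (z n).2 < (r + d / 2)%:E.
  apply: (zW [set w | w < (r + d / 2)%:E]); apply: open_nbhs_nbhs; split.
    exact: open_ereal_lt_ereal.
  by rewrite /= lte_fin ltrDl divr_gt0.
near=> n.
have ln : (r - d / 2)%:E < low_value F (z n).1 by near: n.
have un : upp_value F (z n).2 < (r + d / 2)%:E by near: n.
have lo y : (r - d / 2)%:E < F (z n).1 y.
  exact: lt_le_trans ln (low_value_le _ _).
have up x : F x (z n).2 < (r + d / 2)%:E.
  exact: le_lt_trans (upp_value_ge _ _) un.
have [q qE] : exists q, F (z n).1 (z n).2 = q%:E.
  by move: (lo (z n).2) (up (z n).1); case: (F _ _) => [q| |]// _ _; exists q.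
have := lo (z n).2; have := up (z n).1; rewrite qE !lte_fin => qu ql; split => //.
- move=> x; apply: le_trans (ltW (up x)) _; rewrite -EFinD lee_fin; lra.
- move=> y; apply: (@le_trans _ _ ((r - d / 2)%:E + d%:E)).
    rewrite -EFinD lee_fin; lra.
  by rewrite leeD2r// ltW.
Unshelve. all: by end_near. Qed.

End SaddleValues.

(** * Saddle points of perturbed functions *)

Lemma perturbD (R : realType) (X Y : Type) (F : X -> Y -> \bar R)
    (s h : X -> R) (u k : Y -> R) x y :
  perturb F (fun x => s x + h x) (fun y => u y + k y) x y =
  perturb (perturb F s u) h k x y.
Proof.
rewrite /perturb; case: (F x y) => [r| |]//=; rewrite -!EFinD; congr EFin; ring.
Qed.

Lemma perturb_dist (R : realType) (X Y : topologicalType) (F : X -> Y -> \bar R)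
    (s s' : bcfun X R) (u u' : bcfun Y R) (d : R) x y :
  `|s - s'| <= d -> `|u - u'| <= d ->
  (perturb F s u x y <= perturb F s' u' x y + (2 * d)%:E)%E.
Proof.
move=> sd ud.
have sx : s x - s' x <= d.
  exact: le_trans (ler_norm _) (le_trans (supnorm_ubound (s - s') x) sd).
have uy : u y - u' y <= d.
  exact: le_trans (ler_norm _) (le_trans (supnorm_ubound (u - u') y) ud).
rewrite /perturb; case: (F x y) => [r| |]//=.
by rewrite -!EFinD lee_fin; lra.
Qed.

(** Passing from s + u to s' + u' and back costs 2 d each time. *)
Lemma saddle_perturb_approx (R : realType) (X Y : topologicalType)
    (F : X -> Y -> \bar R) (s s' : bcfun X R) (u u' : bcfun Y R) (d : R) z x y :
  `|s - s'| <= d -> `|u - u'| <= d -> saddle_points (perturb F s' u') z ->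
  (perturb F s u x z.2 <= perturb F s u z.1 y + (4 * d)%:E)%E.
Proof.
move=> sd ud zS; have [xz zy] := zS x y.
have ds : `|s' - s| <= d by rewrite distrC.
have du : `|u' - u| <= d by rewrite distrC.
apply: le_trans (perturb_dist F x z.2 sd ud) _.
apply: (@le_trans _ _ (perturb F s' u' z.1 y + (2 * d)%:E)%E).
  by rewrite leeD2r// (le_trans xz).
apply: (@le_trans _ _ (perturb F s u z.1 y + (2 * d)%:E + (2 * d)%:E)%E).
  by rewrite leeD2r// perturb_dist.
by rewrite -addeA -EFinD (_ : 2 * d + 2 * d = 4 * d)//; ring.
Qed.

(** If the value at the saddle point p were +oo, the saddle inequality would make
    f p.1 y = +oo for all y, hence v_f (p.1) = +oo; if it were -oo, then
    similarly w_f (p.2) = -oo. *)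
Lemma saddle_perturb_fin (R : realType) (X Y : Type) (f : X -> Y -> \bar R)
    (s : X -> R) (u : Y -> R) p :
  bounded_above (low_value f) -> bounded_below (upp_value f) ->
  saddle_points (perturb f s u) p -> perturb f s u p.1 p.2 \is a fin_num.
Proof.
move=> [M fM] [m mf] pS; rewrite fin_numE; apply/andP; split; apply/eqP => Fp.
- have := mf p.2; rewrite leNgt => /negP; apply.
  apply: le_lt_trans (ltNyr m); apply: ge_ereal_sup => _ [x _ <-].
  have [+ _] := pS x p.2; rewrite Fp /perturb.
  by case: (f x p.2).
- have := fM p.1; rewrite leNgt => /negP; apply.
  apply: lt_le_trans (ltry M) _; apply: le_ereal_inf_tmp => _ [y _ <-].
  have [_] := pS p.1 y; rewrite Fp /perturb.
  by case: (f p.1 y).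
Qed.

(** The first perturbation is minus the penalty touching F (., z.2) at z.1, the
    second is the penalty touching - F (z.1, .) at z.2.  Both vanish at their
    base points, so the value at z is unchanged, only the first acts on the line
    y = z.2, and only the second on the line x = z.1. *)
Lemma approx_saddle_perturb (R : realType) (X Y : topologicalType)
    (crX : completely_regular_space X) (crY : completely_regular_space Y)
    (F : X -> Y -> \bar R) (z : X * Y) (d : R) :
  upper_semicontinuous (fun x => F x z.2) ->
  lower_semicontinuous (fun y => F z.1 y) -> 0 < d ->
  F z.1 z.2 \is a fin_num ->
  (forall x, F x z.2 <= F z.1 z.2 + d%:E)%E ->
  (forall y, F z.1 z.2 <= F z.1 y + d%:E)%E ->
  exists (h : bcfun X R) (k : bcfun Y R),
    [/\ `|h| <= 2 * d, `|k| <= 2 * d & saddle_points (perturb F h k) z].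
Proof.
move=> uF lF d0 Fz Fx Fy.
have [h [h0 hd hF]] := penalty_touching crX uF Fz d0 Fx.
have Gz : (- F z.1 z.2)%E \is a fin_num by rewrite fin_numN.
have Gy y : (- F z.1 y <= - F z.1 z.2 + d%:E)%E.
  by move: (Fy y); rewrite -leeBlDr// -leeN2 oppeB ?fin_num_adde_defl.
have [k [k0 kd kF]] :=
  penalty_touching crY ((lower_semicontinuousN _).1 lF) Gz d0 Gy.
have hN x : (- h : bcfun X R) x = - h x by [].
exists (- h), k; split; rewrite ?normrN// => x y.
rewrite /perturb !hN h0 oppr0 k0 !adde0; split.
  by rewrite EFinN leeBlDr.
by have := kF y; rewrite -leeBlDr// -leeN2 oppeB ?fin_num_adde_defl// !oppeK.
Qed.

(** * Well-posedness and upper semicontinuity *)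

Theorem theorem4p4 (R : realType) (X Y : topologicalType)
  (crX : completely_regular_space X) (hX : hausdorff_space X)
  (crY : completely_regular_space Y) (hY : hausdorff_space Y)
  (f : X -> Y -> \bar R)
  (A1 : forall y : Y, upper_semicontinuous (fun x => f x y))
  (A2 : bounded_above (low_value f) /\ eproper (low_value f))
  (A3 : forall x : X, lower_semicontinuous (fun y => f x y))
  (A4 : bounded_below (upp_value f) /\ eproper (upp_value f))
  (s : bcfun X R) (u : bcfun Y R) :
  single_valued_at (saddle_map f) (s, u) /\ set_usc_at (saddle_map f) (s, u)
  <-> saddle_well_posed (perturb f s u).
Proof.
set F := perturb f s u.
have uF y : upper_semicontinuous (fun x => F x y).
  have [cs _] := (bcontP s).1 (bcfun_in s).
  apply: upper_semicontinuousD; last exact: cst_continuous.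
  exact: upper_semicontinuousD.
have lF x : lower_semicontinuous (fun y => F x y).
  have [cu _] := (bcontP u).1 (bcfun_in u).
  apply: lower_semicontinuousD => //.
  apply: lower_semicontinuousD => //; exact: cst_continuous.
split.
- move=> [[p Sp] usc]; exists p => // z zF A /= pA.
  have [U [oU Up] UA] : exists2 U, open_nbhs p U & U `<=` A.
    by rewrite nbhsE in pA.
  have [|N /nbhs_ballP[e /= e0 eN] NU] := usc U oU; first by rewrite Sp => _ ->.
  (* With d = e / 4 the perturbations, of norm at most 2 d, stay below e. *)
  have d0 : 0 < e / 4 by rewrite divr_gt0.
  have := optimizing_approx_saddle d0 zF; apply: filterS => n [zfin zx zy].
  apply: UA.
  have [h [k [he ke hk]]] :=
    approx_saddle_perturb crX crY (uF _) (lF _) d0 zfin zx zy.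
  apply: (NU (s + h, u + k)).
    apply: eN; split => /=; rewrite -ball_normE /ball_ /= opprD addNKr normrN;
    [apply: le_lt_trans he _|apply: le_lt_trans ke _]; lra.
  move=> x y; have := hk x y.
  by rewrite -!perturbD.
- move=> [p Sp wp]; split; first by exists p.
  move=> O oO; rewrite [saddle_map _ _]Sp => pO.
  apply: contrapT => noN.
  have /choice[tz tzP] : forall n : nat,
      exists tz : (bcfun X R * bcfun Y R) * (X * Y),
      [/\ ball (s, u) n.+1%:R^-1 tz.1, saddle_map f tz.1 tz.2 & ~ O tz.2].
    move=> n; apply: contrapT => no; apply: noN.
    exists (ball (s, u) n.+1%:R^-1); first exact: nbhsx_ballx.
    move=> t nt z Sz; apply: contrapT => Oz; apply: no; by exists (t, z).
  have pF : saddle_points F p by rewrite Sp.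
  have [Vp Wp] := saddle_value pF.
  have Fp := fineK (saddle_perturb_fin A2.1 A4.1 pF).
  have zF : optimizing F (fun n => (tz n).2).
    apply: (@optimizing_of_approx_saddle _ _ _ _ (fine (F p.1 p.2)) _
        (fun n => 4 * n.+1%:R^-1)); rewrite ?Fp//.
      rewrite -[X in _ --> X](mulr0 4).
      by apply: cvgM; [exact: cvg_cst|exact: cvg_harmonic].
    move=> n x y; have [[/= bs bu] Sz _] := tzP n.
    apply: saddle_perturb_approx Sz;
      by move: bs bu; rewrite -!ball_normE /ball_ /= => /ltW ? /ltW.
  have nO : nbhs p O by apply: open_nbhs_nbhs; split => //; exact: pO.
  have [N _ /(_ N (leqnn N)) OzN] := wp _ zF O nO.
  by have [_ _] := tzP N; exact.
Qed.
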